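(* Let $A$ be a $C^*$-algebra, $H$ a Hilbert $A$-module, and let $P,Q\in\mathcal{L}(H)$ be two projections such that $\overline{\mathcal{R}(I-Q+P)}$ is orthogonally complemented in $H$. Then $\overline{\mathcal{R}(QP)}$ is also orthogonally complemented in $H$ and $$P_{\overline{\mathcal{R}(QP)}}=Q-P_{\mathcal{R}(Q)\cap\mathcal{N}(P)}.$$
   Context: $\mathcal{L}(H)$ is the $C^*$-algebra of adjointable operators on the Hilbert $A$-module $H$; a projection is $P\in\mathcal{L}(H)$ with $P=P^2=P^*$; $\mathcal{R}$ and $\mathcal{N}$ denote range and null space. A closed submodule $M\subseteq H$ is orthogonally complemented in $H$ if $H=M+M^\perp$, where $M^\perp=\{x\in H:\langle x,y\rangle=0\ \forall y\in M\}$; then $P_M$ denotes the projection in $\mathcal{L}(H)$ with range $M$. Under the hypothesis, $\mathcal{R}(Q)\cap\mathcal{N}(P)=\overline{\mathcal{R}(I-Q+P)}^{\perp}$ is orthogonally complemented, so $P_{\mathcal{R}(Q)\cap\mathcal{N}(P)}$ is meaningful. *)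

(* Defs.v *)
From HB Require Import structures.
From mathcomp Require Import all_boot all_order all_algebra.
From mathcomp Require Import complex.
From mathcomp Require Import boolp classical_sets functions reals.
From mathcomp Require Import topology normedtype.
Import Order.TTheory GRing.Theory Num.Theory numFieldNormedType.Exports.

Set Implicit Arguments.
Unset Strict Implicit.
Unset Printing Implicit Defensive.

Local Open Scope classical_set_scope.
Local Open Scope ring_scope.

(* C*-algebras are not assumed unital, which is why the product is not the one
   of the library's rings. In a normed module over R[i] the norm is R[i]-valued,
   with nonnegative real values. *)
HB.mixin Record CompleteNormedModule_isCStarAlgebra (R : realType) A
    of CompleteNormedModule R[i] A := {
  amul : A -> A -> A;
  astar : A -> A;
  amulA : associative amul;
  amulDl : left_distributive amul +%R;
  amulDr : right_distributive amul +%R;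
  amulZl : forall (c : R[i]) a b, amul (c *: a) b = c *: amul a b;
  amulZr : forall (c : R[i]) a b, amul a (c *: b) = c *: amul a b;
  astarK : involutive astar;
  astarD : {morph astar : a b / a + b};
  astarZ : forall (c : R[i]) a, astar (c *: a) = c^* *: astar a;
  astarM : forall a b, astar (amul a b) = amul (astar b) (astar a);
  ler_norm_amul : forall a b, `|amul a b| <= `|a| * `|b|;
  norm_amul_star : forall a, `|amul (astar a) a| = `|a| ^+ 2
}.

#[short(type="cstarAlgType")]
HB.structure Definition CStarAlgebra (R : realType) :=
  {A of CompleteNormedModule R[i] A & CompleteNormedModule_isCStarAlgebra R A}.

Definition apositive (R : realType) (A : cstarAlgType R) (a : A) : Prop :=
  exists b : A, a = amul (astar b) b.

(* Right Hilbert A-modules, with inner product conjugate-linear in the first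
   variable and linear in the second. The norm of the underlying Banach space is
   the one induced by the inner product (hip_norm), which also makes the inner
   product definite. *)
HB.mixin Record CompleteNormedModule_isHilbertModule (R : realType)
    (A : cstarAlgType R) H of CompleteNormedModule R[i] H := {
  hact : H -> A -> H;
  hip : H -> H -> A;
  hactDl : forall x y a, hact (x + y) a = hact x a + hact y a;
  hactDr : forall x a b, hact x (a + b) = hact x a + hact x b;
  hactA : forall x a b, hact x (amul a b) = hact (hact x a) b;
  hactZl : forall (c : R[i]) x a, hact (c *: x) a = c *: hact x a;
  hactZr : forall (c : R[i]) x a, hact x (c *: a) = c *: hact x a;
  hipDr : forall x y z, hip x (y + z) = hip x y + hip x z;
  hipZr : forall (c : R[i]) x y, hip x (c *: y) = c *: hip x y;
  hip_act : forall x y a, hip x (hact y a) = amul (hip x y) a;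
  hip_star : forall x y, hip y x = astar (hip x y);
  hip_pos : forall x, apositive (hip x x);
  hip_norm : forall x, `|x| ^+ 2 = `|hip x x|
}.

#[short(type="hilbertModType")]
HB.structure Definition HilbertModule (R : realType) (A : cstarAlgType R) :=
  {H of CompleteNormedModule R[i] H & CompleteNormedModule_isHilbertModule R A H}.

Section Operators.
Variables (R : realType) (A : cstarAlgType R) (H : hilbertModType A).
Implicit Types (x y z : H) (T S P Q : H -> H) (M : set H).

(* The elements of L(H) are all maps with an adjoint: such a map is
   automatically bounded, R[i]-linear and A-linear, and its adjoint is unique.
   Hence is_adjoint T T expresses that T is its own adjoint. *)
Definition is_adjoint T S : Prop := forall x y, hip (T x) y = hip x (S y).

Definition adjointable T : Prop := exists S, is_adjoint T S.

Definition projection P : Prop :=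
  [/\ adjointable P, P \o P = P & is_adjoint P P].

Definition null_space T : set H := T @^-1` [set 0].

Definition closed_submodule M : Prop :=
  [/\ closed M, M 0, (forall x y, M x -> M y -> M (x + y)),
      (forall (c : R[i]) x, M x -> M (c *: x)) &
      (forall x (a : A), M x -> M (hact x a))].

Definition ortho M : set H := [set x | forall y, M y -> hip x y = 0].

Definition orth_complemented M : Prop :=
  closed_submodule M /\ [set x + y | x in M & y in ortho M] = setT.

(* The projection with range M; it exists and is unique as soon as M is
   orthogonally complemented (orth_projP, orth_proj_unique); the value 0 is a
   default for the other sets M. *)
Definition orth_proj M : H -> H :=
  xget (fun=> 0) [set P | projection P /\ range P = M].

Lemma hip0r x : hip x 0 = 0.
Proof. by rewrite -[in LHS](scale0r 0) hipZr scale0r. Qed.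

Lemma astar0 : astar 0 = 0 :> A.
Proof. by rewrite -[in LHS](scale0r 0) astarZ rmorph0 scale0r. Qed.

Lemma hipC0 x y : hip x y = 0 -> hip y x = 0.
Proof. by move=> e; rewrite hip_star e astar0. Qed.

Lemma hipDl x y z : hip (x + y) z = hip x z + hip y z.
Proof. by rewrite hip_star hipDr astarD -!hip_star. Qed.

Lemma hipZl (c : R[i]) x y : hip (c *: x) y = c^* *: hip x y.
Proof. by rewrite hip_star hipZr astarZ -hip_star. Qed.

Lemma hipBr x y z : hip x (y - z) = hip x y - hip x z.
Proof. by rewrite -scaleN1r hipDr hipZr scaleN1r. Qed.

Lemma hipBl x y z : hip (x - y) z = hip x z - hip y z.
Proof. by rewrite -scaleN1r hipDl hipZl rmorphN rmorph1 scaleN1r. Qed.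

Lemma hip0_eq0 x : hip x x = 0 -> x = 0.
Proof.
move=> e; have := hip_norm x; rewrite e normr0 => /eqP.
by rewrite expf_eq0 /= normr_eq0 => /eqP.
Qed.

Lemma hip_inj x y : (forall z, hip x z = hip y z) -> x = y.
Proof.
by move=> e; apply/eqP; rewrite -subr_eq0; apply/eqP/hip0_eq0;
  rewrite hipBl e subrr.
Qed.

Lemma polar x y : 2%:R *: hip x y =
  (hip (x + y) (x + y) - hip x x - hip y y) -
  'i *: (hip (x + 'i *: y) (x + 'i *: y) - hip x x - hip y y).
Proof.
have aux (a b c d : A) : a + b + (c + d) - a - d = b + c.
  by rewrite [a + b]addrC addrACA -[LHS]addrA -opprD addrK.
have ii : 'i * 'i = -1 :> R[i] by rewrite -expr2 sqrCi.
have iy : hip ('i *: y) ('i *: y) = hip y y.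
  by rewrite hipZl hipZr scalerA conjCi mulNr ii opprK scale1r.
rewrite -[X in _ - 'i *: (_ - X)]iy.
rewrite !(hipDl x, hipDr) !aux hipZl hipZr conjCi scalerDr !scalerA mulrN ii.
rewrite opprK scale1r scaleN1r opprD opprK [RHS]addrACA subrr addr0 -mulr2n.
by rewrite scaler_nat.
Qed.

Lemma hip_bounded x : exists2 K : R[i], 0 < K &
  forall y, `|y| <= 1 -> `|hip x y| <= K.
Proof.
pose B : R[i] := (`|x| + 1) ^+ 2 + `|x| ^+ 2 + 1.
have B1 : 1 <= B by rewrite lerDr addr_ge0 ?exprn_ge0 ?addr_ge0.
have B0 : 0 < B by apply: lt_le_trans B1.
exists B => // y y1.
have bd z : `|z| <= 1 ->
    `|hip (x + z) (x + z) - hip x x - hip z z| <= B.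
  move=> z1; rewrite (le_trans (ler_normB _ _))// lerD//; last first.
    by rewrite -hip_norm exprn_ile1.
  rewrite (le_trans (ler_normB _ _))// -!hip_norm lerD2r lerXn2r ?nnegrE ?addr_ge0//.
  by rewrite (le_trans (ler_normD _ _))// lerD2l.
have iy1 : `|('i : R[i]) *: y| <= 1 by rewrite normrZ normCi mul1r.
have yy : hip ('i *: y) ('i *: y) = hip y y.
  by rewrite hipZl hipZr scalerA conjCi mulNr -expr2 sqrCi opprK scale1r.
rewrite -(ler_pM2l (_ : 0 < 2%:R :> R[i])) ?ltr0n//.
rewrite -[X in X * _](@normr_nat R[i]) -normrZ polar.
rewrite (le_trans (ler_normB _ _))// normrZ normCi mul1r mulrDl mul1r lerD ?bd//.
by rewrite -[X in _ - X]yy bd.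
Qed.

Lemma closed_hip0 x : closed [set y | hip x y = 0].
Proof.
have [K K0 HK] := hip_bounded x.
move=> z clz; apply/eqP; apply: contraT => nz /=.
have c0 : 0 < `|hip x z| by rewrite normr_gt0.
have e0 : 0 < `|hip x z| / (2%:R * K) by rewrite divr_gt0 ?mulr_gt0.
have [m [/= xm]] := clz _ (nbhsx_ballx z _ e0).
rewrite -ball_normE /= => zm.
set e := _ / _ in e0 zm.
have := HK (e^-1 *: (z - m)).
rewrite normrZ gtr0_norm ?invr_gt0// mulrC ler_pdivrMr// mul1r => /(_ (ltW zm)).
rewrite hipZr hipBr xm subr0 normrZ gtr0_norm ?invr_gt0//.
rewrite mulrC ler_pdivrMr// /e => le.
have : K * (`|hip x z| / (2%:R * K)) < `|hip x z|.
  rewrite mulrCA invfM [K * (_ * _)]mulrCA mulfV ?gt_eqF// mulr1.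
  by rewrite ltr_pdivrMr ?ltr0n// ltr_pMr ?ltr1n.
by move=> /(le_lt_trans le); rewrite ltxx.
Qed.

Lemma orth_proj_unique M P Q : projection P -> projection Q ->
  range P = M -> range Q = M -> P = Q.
Proof.
move=> [_ PP Pa] [_ QQ Qa] rP rQ.
have fixP y : M y -> P y = y.
  by rewrite -rP => -[z _ <-]; rewrite -[LHS]/((P \o P) z) PP.
have fixQ y : M y -> Q y = y.
  by rewrite -rQ => -[z _ <-]; rewrite -[LHS]/((Q \o Q) z) QQ.
apply/funext => x; apply: hip_inj => y.
have <- : P (Q x) = Q x by apply: fixP; rewrite -rQ; exists x.
by rewrite !Pa Qa fixQ // -rP; exists y.
Qed.

Lemma orth_projP M : orth_complemented M ->
  projection (orth_proj M) /\ range (orth_proj M) = M.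
Proof.
move=> [[_ M0 MD MZ _] MM].
suff [P] : exists P, projection P /\ range P = M.
  move=> h; have ex : [set P : H -> H | projection P /\ range P = M] !=set0.
    by exists P.
  exact: (xgetPex (fun=> 0) ex).
have dec x : exists y, M y /\ ortho M (x - y).
  have : setT x by []. rewrite -MM => -[y My [z oz <-]]; exists y; split=> //.
  by rewrite addrAC subrr add0r.
have [P HP] := choice dec.
have PM x : M x -> P x = x.
  move=> Mx; have [MPx oPx] := HP x.
  have : hip (x - P x) (x - P x) = 0.
    by apply: oPx; apply: MD => //; rewrite -scaleN1r; apply: MZ.
  by move/hip0_eq0/eqP; rewrite subr_eq0 => /eqP.
have Pip x y : hip (P x) y = hip (P x) (P y).
  apply/eqP; rewrite -subr_eq0 -hipBr; apply/eqP/hipC0.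
  by apply: (HP y).2; exact: (HP x).1.
have Pa : is_adjoint P P by move=> x y; rewrite Pip hip_star -Pip -hip_star.
exists P; split; first split=> //; first by exists P.
  by apply/funext => x /=; apply: PM; exact: (HP x).1.
apply/seteqP; split=> [_ [x _ <-]|x Mx]; first exact: (HP x).1.
by exists x => //; exact: PM.
Qed.

Lemma orth_complemented_ortho M : orth_complemented M ->
  orth_complemented (ortho M).
Proof.
move=> [_ MM]; split; last first.
  apply/seteqP; split=> // x _; have : setT x by [].
  rewrite -MM => -[y My [z oz <-]]; exists z => //; exists y; last exact: addrC.
  by move=> w ow; apply/hipC0/ow.
have -> : ortho M = \bigcap_(y in M) [set x | hip y x = 0].
  by apply/seteqP; split=> x h y My; apply/hipC0/h.
split.
- by apply: closed_bigI => y _; exact: closed_hip0.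
- by move=> y _ /=; exact: hip0r.
- by move=> x y hx hy z Mz /=; rewrite hipDr hx// hy// addr0.
- by move=> c x hx z Mz /=; rewrite hipZr hx// scaler0.
- move=> x a hx z Mz /=; rewrite hip_act hx//.
  by rewrite -[X in amul X _](scale0r 0) amulZl scale0r.
Qed.

Lemma ortho_closure_range P Q : projection P -> projection Q ->
  ortho (closure (range (idfun \- Q \+ P))) = range Q `&` null_space P.
Proof.
move=> [_ PP Pa] [_ QQ Qa].
have PPx x : P (P x) = P x by rewrite -[LHS]/((P \o P) x) PP.
have QQx x : Q (Q x) = Q x by rewrite -[LHS]/((Q \o Q) x) QQ.
have Ta x y : hip x ((idfun \- Q \+ P) y) = hip ((idfun \- Q \+ P) x) y.
  rewrite /= hipDr hipBr hipDl hipBl. by rewrite Qa Pa.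
apply/seteqP; split=> x.
  move=> ox.
  have Tx0 : (idfun \- Q \+ P) x = 0.
    apply: hip_inj => y; rewrite -Ta ox; last by apply: subset_closure; exists y.
    by apply/esym/hipC0/hip0r.
  move: (Tx0) => /= /eqP; rewrite addr_eq0 => /eqP uv.
  have uu : hip (x - Q x) (x - Q x) = hip (x - Q x) x.
    rewrite hipBr [X in _ - X](_ : _ = 0) ?subr0//.
    by rewrite hipBl Qa QQx subrr.
  have vv : hip (P x) (P x) = hip (P x) x by rewrite Pa PPx -Pa.
  have : hip (x - Q x) (x - Q x) + hip (P x) (P x) = 0.
    rewrite uu vv -hipDl [X in hip X _]Tx0; exact/hipC0/hip0r.
  rewrite uv -scaleN1r hipZl hipZr scalerA rmorphN rmorph1 mulrNN mulr1 scale1r.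
  rewrite -mulr2n -scaler_nat => /eqP.
  rewrite scaler_eq0 pnatr_eq0 /= => /eqP/hip0_eq0 Px0.
  split=> //; exists x => //; apply/esym/eqP.
  by rewrite -subr_eq0 uv Px0 oppr0.
move=> [[z _ <-] Pz] y cly.
have : closed [set y | hip (Q z) y = 0] by exact: closed_hip0.
move=> cl; apply: cl; apply: closureS cly => _ [w _ <-] /=.
rewrite -[X in hip _ X]/((idfun \- Q \+ P) w) Ta /= QQx subrr add0r.
by rewrite (_ : P (Q z) = 0) //; exact/hipC0/hip0r.
Qed.

Lemma orth_complemented_range_null_space P Q : projection P -> projection Q ->
  orth_complemented (closure (range (idfun \- Q \+ P))) ->
  orth_complemented (range Q `&` null_space P).
Proof.
by move=> hP hQ /orth_complemented_ortho; rewrite ortho_closure_range.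
Qed.

End Operators.

(* Main.v *)
Require Import Defs.
From mathcomp Require Import all_boot all_order all_algebra.
From mathcomp Require Import complex.
From mathcomp Require Import boolp classical_sets functions reals.
From mathcomp Require Import topology normedtype.
From mathcomp Require Import ring.
Import Order.TTheory GRing.Theory Num.Theory numFieldNormedType.Exports.

Local Open Scope classical_set_scope.
Local Open Scope ring_scope.

(** Put [T = I - Q + P], [N = R(Q) \cap N(P)] and let [E] be the projection onto
    [N]. Since [E <= Q] and [E P = 0], [F = Q - E] is a projection fixing [R(QP)].
    Conversely a vector [x] of [R(F)] is orthogonal to [N], hence lies in
    [closure R(T)] because that submodule is complemented with complement [N];
    as [Q T = Q P] and [Q] is continuous, [x = Q x] is in [closure R(QP)]. *)

Section Projections.
Set Implicit Arguments.
Unset Strict Implicit.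
Variables (R : realType) (A : cstarAlgType R) (H : hilbertModType A).
Implicit Types (x y z : H) (T S P Q : H -> H) (M : set H).

Lemma hip0l x : hip 0 x = 0.
Proof. exact/hipC0/hip0r. Qed.

(** Linearity is not part of [is_adjoint]: it follows by moving [T] across the inner product, which
    separates points. *)
Lemma adjoint_subr T S x y : is_adjoint T S -> T (x - y) = T x - T y.
Proof. by move=> TS; apply: hip_inj => z; rewrite TS !hipBl !TS. Qed.

Lemma projection_idem P x : projection P -> P (P x) = P x.
Proof. by move=> [_ PP _]; rewrite -[LHS]/((P \o P) x) PP. Qed.

(* Any constant suffices for continuity; 2 comes from
   [<Px + x, Px + x> = 3 <Px, Px> + <x, x>], which spares the monotonicity of the
   norm on the positive elements of [A]. *)
Lemma projection_norm_le P x : projection P -> `|P x| <= 2%:R * `|x|.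
Proof.
move=> hP; have [_ _ Pa] := hP.
have PxPx : hip (P x) (P x) = hip (P x) x by rewrite [RHS]Pa -Pa projection_idem.
have PxP : hip x (P x) = hip (P x) (P x) by rewrite PxPx Pa.
have e3 : 3%:R *: hip (P x) (P x) = hip (P x + x) (P x + x) - hip x x.
  rewrite hipDl !hipDr PxP -PxPx addrA addrK scaler_nat.
  by rewrite !mulrS mulr0n addr0 !addrA.
have : 3%:R * `|P x| ^+ 2 <= (`|P x| + `|x|) ^+ 2 + `|x| ^+ 2.
  rewrite [`|P x| ^+ 2]hip_norm -[X in X * _](@normr_nat R[i]) -normrZ e3.
  rewrite (le_trans (ler_normB _ _))// -!hip_norm lerD2r.
  by rewrite lerXn2r ?nnegrE ?addr_ge0// ler_normD.
set q := `|P x|; set m := `|x| => le.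
have q0 : 0 <= q by exact: normr_ge0.
have m0 : 0 <= m by exact: normr_ge0.
have [->|qn0] := eqVneq q 0; first by rewrite mulr_ge0.
have qm : 0 < q + m by rewrite ltr_wpDr// lt_neqAle eq_sym qn0.
(* Here [le] says [2 q^2 - 2 q m - 2 m^2 <= 0]. Subtracting a further [2 m^2] makes the left side
   factor as [2 (q - 2 m) (q + m)], and [q + m > 0]. *)
rewrite -subr_le0 -(pmulr_lle0 _ qm).
rewrite -(pmulr_rle0 _ (_ : 0 < 2%:R :> R[i])) ?ltr0n//.
have -> : 2%:R * ((q - 2%:R * m) * (q + m)) =
  (3%:R * q ^+ 2 - ((q + m) ^+ 2 + m ^+ 2)) - 2%:R * m ^+ 2 by ring.
by rewrite subr_le0 (le_trans (_ : _ <= 0)) ?subr_le0// mulr_ge0// exprn_ge0.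
Qed.

Lemma projection_closure_range P T x : projection P ->
  closure (range T) x -> closure (range (P \o T)) (P x).
Proof.
move=> hP clx B /nbhs_ballP[e /= e0 eB]; have [_ _ Pa] := hP.
(* Halving the radius offsets the Lipschitz constant 2 of [P]. *)
have e20 : 0 < e / 2%:R by rewrite divr_gt0.
have [_ [[z _ <-]]] := clx _ (nbhsx_ballx x _ e20).
rewrite -ball_normE /= => xz; exists (P (T z)); split; first by exists z.
apply: eB; rewrite -ball_normE /= -(adjoint_subr _ _ Pa).
by rewrite (le_lt_trans (projection_norm_le _ hP))// mulrC -ltr_pdivlMr.
Qed.

Lemma range_projectionE P : projection P -> range P = [set x | P x = x].
Proof.
move=> hP; apply/seteqP; split=> [_ [z _ <-]|x Px]; last by exists x.
exact: projection_idem.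
Qed.

(** As [P] is self-adjoint, its fixed points are the vectors orthogonal to every [P z - z], and each
    of these conditions is closed. *)
Lemma closed_range_projection P : projection P -> closed (range P).
Proof.
move=> hP; have [_ _ Pa] := hP.
have -> : range P = \bigcap_z [set x | hip (P z - z) x = 0].
  rewrite range_projectionE//; apply/seteqP; split=> x /= h.
    by move=> z _ /=; rewrite hipBl Pa h subrr.
  apply: hip_inj => z; apply/eqP; rewrite -subr_eq0 -hipBl; apply/eqP/hipC0.
  by rewrite hipBr -Pa -hipBl; exact: h.
by apply: closed_bigI => z _; exact: closed_hip0.
Qed.

Lemma orth_complemented_range P : projection P -> orth_complemented (range P).
Proof.
move=> hP; have [_ _ Pa] := hP.
split; last first.
  apply/seteqP; split=> // x _; exists (P x); first by exists x.
  exists (x - P x); last by rewrite addrC subrK.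
  by move=> _ [z _ <-]; rewrite hipBl [X in _ - X]Pa projection_idem// subrr.
split; first exact: closed_range_projection.
(* Each remaining closure property is an instance of linearity or [A]-linearity of [P], obtained by
   testing against all [z]. *)
all: rewrite range_projectionE//=.
- by apply: hip_inj => z; rewrite Pa !hip0l.
- by move=> x y hx hy; apply: hip_inj => z; rewrite Pa !hipDl -!Pa hx hy.
- by move=> c x hx; apply: hip_inj => z; rewrite Pa !hipZl -Pa hx.
- move=> x a hx; apply: hip_inj => z.
  by rewrite Pa ![hip (hact _ _) _]hip_star !hip_act Pa hx.
Qed.

Lemma orth_proj_range P : projection P -> orth_proj (range P) = P.
Proof.
move=> hP; have [hE rE] := orth_projP (orth_complemented_range hP).
exact: orth_proj_unique hE hP rE erefl.
Qed.

(** Split [x = y + z] along [M] and its complement: [z] is orthogonal to both [x] and [y], hence to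
    itself. *)
Lemma ortho_ortho_sub M : orth_complemented M -> Defs.ortho (Defs.ortho M) `<=` M.
Proof.
move=> [_ MM] x ox; have : setT x by [].
rewrite -MM => -[y My [z oz xE]]; rewrite -xE.
suff -> : z = 0 by rewrite addr0.
apply: hip0_eq0; have := hipC0 (ox _ oz).
by rewrite -xE hipDr oz// add0r.
Qed.

(** The inclusion gives [Q P = P], and taking adjoints [P Q = P], so [Q - P] squares to itself. *)
Lemma projection_sub P Q : projection P -> projection Q ->
  range P `<=` range Q -> projection (Q \- P).
Proof.
move=> hP hQ PQ; have [_ _ Pa] := hP; have [_ _ Qa] := hQ.
have QP x : Q (P x) = P x.
  have : range Q (P x) by apply: PQ; exists x.
  by rewrite range_projectionE.
have PQE x : P (Q x) = P x by apply: hip_inj => y; rewrite Pa Qa QP -Pa.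
have Fa : is_adjoint (Q \- P) (Q \- P).
  by move=> x y /=; rewrite hipBl hipBr Pa Qa.
split=> //; first by exists (Q \- P).
apply/funext => x /=.
rewrite (adjoint_subr _ _ Qa) (adjoint_subr _ _ Pa) QP PQE !projection_idem//.
by rewrite subrr subr0.
Qed.

(** Once the closure is the range of a projection, complementation and the formula both follow from
    the general facts on such ranges. *)
Lemma closure_range_comp_projection P Q : projection P -> projection Q ->
  orth_complemented (closure (range (idfun \- Q \+ P))) ->
  closure (range (Q \o P)) = range (Q \- orth_proj (range Q `&` null_space P)).
Proof.
move=> hP hQ hPQ; have [_ _ Pa] := hP; have [_ _ Qa] := hQ.
have [] := orth_projP (orth_complemented_range_null_space hP hQ hPQ).
set N := _ `&` _; set E := orth_proj N => hE rE; have [_ _ Ea] := hE.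
have EN x : N (E x) by rewrite -rE; exists x.
have fixE x : N x -> E x = x by rewrite -rE range_projectionE.
have QE x : Q (E x) = E x.
  by have [+ _] := EN x; rewrite range_projectionE.
have PE x : P (E x) = 0 by have [_ +] := EN x.
(* [EQ] and [EP] are the adjoint forms of [QE] and [PE]. *)
have EQ x : E (Q x) = E x by apply: hip_inj => y; rewrite Ea Qa QE -Ea.
have EP x : E (P x) = 0.
  by apply: hip_inj => y; rewrite Ea Pa PE hip0r hip0l.
have hF : projection (Q \- E).
  by apply: projection_sub => //; rewrite rE => x [].
apply/seteqP; split.
  rewrite (closure_id (range (Q \- E))).1; last exact: closed_range_projection.
  apply: closureS => _ [z _ <-]; exists (Q (P z)) => //=.
  by rewrite EQ EP subr0 projection_idem.
move=> _ [z _ <-].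
have QT : Q \o (idfun \- Q \+ P) = Q \o P.
  apply/funext => x /=; apply: hip_inj => y.
  by rewrite Qa hipDl hipBl [hip (Q x) _]Qa projection_idem// subrr add0r Qa.
(* Writing the vector as its own image under [Q] lets the continuity of [Q] reduce the goal to
   membership in the closure of the range of [I - Q + P]. *)
rewrite -QT; have <- : Q ((Q \- E) z) = (Q \- E) z.
  by rewrite /= (adjoint_subr _ _ Qa) QE projection_idem.
apply: projection_closure_range => //; apply: ortho_ortho_sub => //.
rewrite ortho_closure_range// => n Nn /=.
(* With [n = E n], moving [E] to the left leaves [E (Q z - E z) = E z - E z]. *)
by rewrite -[n]fixE// -Ea (adjoint_subr _ _ Ea) EQ projection_idem// subrr hip0l.
Qed.

End Projections.

Theorem lemma4p1 (R : realType) (A : cstarAlgType R) (H : hilbertModType A)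
    (P Q : H -> H) (hP : projection P) (hQ : projection Q)
    (hPQ : orth_complemented (closure (range (idfun \- Q \+ P)))) :
  orth_complemented (closure (range (Q \o P))) /\
  orth_proj (closure (range (Q \o P)))
    = Q \- orth_proj (range Q `&` null_space P).
Proof.
have [hE rE] := orth_projP (orth_complemented_range_null_space hP hQ hPQ).
have hF : projection (Q \- orth_proj (range Q `&` null_space P)).
  by apply: projection_sub => //; rewrite rE => x [].
rewrite closure_range_comp_projection//; split.
  exact: orth_complemented_range.
exact: orth_proj_range.
Qed.
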